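(* Let $L>2$ be an integer, let $\alpha_t,w_t\in\mathbb{C}$, $t=1,\dots,r_1$, and $\beta_t,z_t\in\mathbb{C}$, $t=1,\dots,r_2$, be given constants, and let $B_L\in\mathbb{C}^{2^L\times2^L}$ be the circulant matrix whose first column has the entries $$(B_L)_j=\alpha_1w_1^j+\dots+\alpha_{r_1}w_{r_1}^j+\beta_1z_1^{2^L-j}+\dots+\beta_{r_2}z_{r_2}^{2^L-j},\qquad j=0,\dots,2^L-1.$$ Then $B_L$ admits an explicit QTT representation with the ranks $(2,r_1+r_2+1,r_1+r_2+1,\dots,r_1+r_2+1)$: $$B_L=Q_1\Join Q_2\Join\dots\Join Q_L,$$ where $$Q_1=\begin{bmatrix}I&H\end{bmatrix},\qquad Q_2=\begin{bmatrix}I&K_{1,2}&\cdots&K_{r_1,2}&\widetilde K_{1,2}&\cdots&\widetilde K_{r_2,2}\\0&M_{1,2}&\cdots&M_{r_1,2}&\widetilde M_{1,2}&\cdots&\widetilde M_{r_2,2}\end{bmatrix},$$ $$Q_k=\begin{bmatrix}I&K_{1,k}&\cdots&K_{r_1,k}&\widetilde K_{1,k}&\cdots&\widetilde K_{r_2,k}\\&M_{1,k}&&&&&\\&&\ddots&&&&\\&&&M_{r_1,k}&&&\\&&&&\widetilde M_{1,k}&&\\&&&&&\ddots&\\&&&&&&\widetilde M_{r_2,k}\end{bmatrix},\quad k=3,\dots,L-1,$$ $$Q_L=\begin{bmatrix}\gamma_1I+\gamma_2J'+\gamma_3J\\\alpha_1w_1M_{1,L}\\\vdots\\\alpha_{r_1}w_{r_1}M_{r_1,L}\\\beta_1z_1\widetilde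 M_{1,L}\\\vdots\\\beta_{r_2}z_{r_2}\widetilde M_{r_2,L}\end{bmatrix},$$ and where $$K_{t,k}=J'+q_{t,k}^{2^k-2}J,\quad M_{t,k}=q_{t,k}I+q_{t,k}^2J'+J,\quad q_{t,k}=w_t^{2^{L-k}},$$ $$\widetilde K_{t,k}=\widetilde q_{t,k}^{\,2^k-2}J'+J,\quad\widetilde M_{t,k}=\widetilde q_{t,k}I+J'+\widetilde q_{t,k}^{\,2}J,\quad\widetilde q_{t,k}=z_t^{2^{L-k}},$$ $$\gamma_1=\sum_{t=1}^{r_1}\alpha_t+\sum_{t=1}^{r_2}\beta_tz_t^{2^L},\quad\gamma_2=\sum_{t=1}^{r_1}\alpha_tw_t+\sum_{t=1}^{r_2}\beta_tz_t^{2^L-1},\quad\gamma_3=\sum_{t=1}^{r_1}\alpha_tw_t^{2^L-1}+\sum_{t=1}^{r_2}\beta_tz_t.$$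
   Context: Blocks: $I=\begin{bmatrix}1&0\\0&1\end{bmatrix}$, $J=\begin{bmatrix}0&1\\0&0\end{bmatrix}$, $J'=\begin{bmatrix}0&0\\1&0\end{bmatrix}$, $H=J+J'=\begin{bmatrix}0&1\\1&0\end{bmatrix}$. Blank entries in block matrices are zero $2\times2$ blocks. A circulant with first column $(c_0,\dots,c_{N-1})^\top$ has entries $c_{(i-j)\bmod N}$, $0\le i,j\le N-1$. The convention $0^0=1$ is used. Strong Kronecker product: if $X$ is a $p\times q$ block matrix with blocks $X_{\alpha\gamma}$ and $Y$ is a $q\times r$ block matrix with blocks $Y_{\gamma\beta}$ (all blocks of $X$ of one common size, all blocks of $Y$ of one common size), then $X\Join Y$ is the $p\times r$ block matrix with blocks $(X\Join Y)_{\alpha\beta}=\sum_{\gamma=1}^qX_{\alpha\gamma}\otimes Y_{\gamma\beta}$, where $\otimes$ is the Kronecker product. A QTT representation of a $2^L\times2^L$ matrix with ranks $(\rho_1,\dots,\rho_{L-1})$ is a factorization $Q_1\Join\dots\Join Q_L$ in which $Q_k$ is a $\rho_{k-1}\times\rho_k$ block matrix with $2\times2$ blocks, with $\rho_0=\rho_L=1$. *)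

(* Defs.v *)
From mathcomp Require Import all_boot all_order all_algebra.
From mathcomp Require Import mxtens complex reals.

Set Implicit Arguments.
Unset Strict Implicit.
Unset Printing Implicit Defensive.

Import GRing.Theory.
Local Open Scope ring_scope.

(* A p x q block matrix with m x n blocks over A is a matrix whose entries are
   matrices, 'M['M[A]_(m, n)]_(p, q). *)

Definition circulant (A : Type) (N : nat) (c : nat -> A) : 'M[A]_N :=
  \matrix_(i < N, j < N) c ((i + N - j) %% N)%N.

Definition strong_kron (A : pzRingType) (m n m' n' p q r : nat)
    (X : 'M['M[A]_(m, n)]_(p, q)) (Y : 'M['M[A]_(m', n')]_(q, r)) :
    'M['M[A]_(m * m', n * n')]_(p, r) :=
  \matrix_(a < p, b < r) \sum_(c < q) tensmx (X a c) (Y c b).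

(* [qtt_cores A p [:: rho_1; ...; rho_l]] is the type of sequences of l.+1
   block matrices with 2 x 2 blocks, of block sizes
   p x rho_1, rho_1 x rho_2, ..., rho_l x 1. *)
Inductive qtt_cores (A : Type) : nat -> seq nat -> Type :=
| QttLast p (Q : 'M['M[A]_2]_(p, 1)) : qtt_cores A p [::]
| QttCons p q rs (Q : 'M['M[A]_2]_(p, q)) (T : qtt_cores A q rs) :
    qtt_cores A p (q :: rs).

(* Iterated strong Kronecker product, bracketed to the right.  The recursive
   case typechecks because 2 ^ n.+2 is convertible to 2 * 2 ^ n.+1. *)
Fixpoint qtt_prod (A : pzRingType) p rs (T : qtt_cores A p rs) :
    'M['M[A]_(2 ^ (size rs).+1)]_(p, 1) :=
  match T in qtt_cores _ p rs return 'M['M[A]_(2 ^ (size rs).+1)]_(p, 1) with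
  | QttLast p Q => Q
  | QttCons p q rs Q T' => strong_kron Q (qtt_prod T')
  end.

Definition qtt_representation (A : pzRingType) (L : nat) (B : 'M[A]_(2 ^ L))
    (ranks : seq nat) (T : qtt_cores A 1 ranks) : Prop :=
  exists eL : (size ranks).+1 = L,
    B = castmx (congr1 (expn 2) eL, congr1 (expn 2) eL) (qtt_prod T 0 0).

Section Blocks.
Variable A : pzRingType.

Definition blkI : 'M[A]_2 := 1%:M.
Definition blkJ : 'M[A]_2 := delta_mx 0 1.
Definition blkJ' : 'M[A]_2 := delta_mx 1 0.
Definition blkH : 'M[A]_2 := blkJ + blkJ'.

End Blocks.
Arguments blkI {A}.
Arguments blkJ {A}.
Arguments blkJ' {A}.
Arguments blkH {A}.

Section ExponentialCirculant.
Variables (A : pzRingType) (L r1 r2 : nat).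
Variables (alpha w : 'I_r1 -> A) (beta z : 'I_r2 -> A).

Definition BL_column (j : nat) : A :=
  \sum_(t < r1) alpha t * w t ^+ j + \sum_(t < r2) beta t * z t ^+ (2 ^ L - j).

Definition BL : 'M[A]_(2 ^ L) := circulant (2 ^ L) BL_column.

Definition q (t : 'I_r1) (k : nat) : A := w t ^+ (2 ^ (L - k)).
Definition K (t : 'I_r1) (k : nat) : 'M[A]_2 :=
  blkJ' + q t k ^+ (2 ^ k - 2) *: blkJ.
Definition M (t : 'I_r1) (k : nat) : 'M[A]_2 :=
  q t k *: blkI + q t k ^+ 2 *: blkJ' + blkJ.

Definition qt (t : 'I_r2) (k : nat) : A := z t ^+ (2 ^ (L - k)).
Definition Kt (t : 'I_r2) (k : nat) : 'M[A]_2 :=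
  qt t k ^+ (2 ^ k - 2) *: blkJ' + blkJ.
Definition Mt (t : 'I_r2) (k : nat) : 'M[A]_2 :=
  qt t k *: blkI + blkJ' + qt t k ^+ 2 *: blkJ.

Definition gamma1 : A :=
  \sum_(t < r1) alpha t + \sum_(t < r2) beta t * z t ^+ (2 ^ L).
Definition gamma2 : A :=
  \sum_(t < r1) alpha t * w t + \sum_(t < r2) beta t * z t ^+ (2 ^ L - 1).
Definition gamma3 : A :=
  \sum_(t < r1) alpha t * w t ^+ (2 ^ L - 1) + \sum_(t < r2) beta t * z t.

(* In the cores, [const_mx X] is the 1 x 1 block matrix with block X. *)

Definition Q1 : 'M['M[A]_2]_(1, 1 + 1) := row_mx (const_mx blkI) (const_mx blkH).

Definition Q2 : 'M['M[A]_2]_(1 + 1, 1 + (r1 + r2)) :=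
  block_mx
    (const_mx blkI) (row_mx (\row_t K t 2) (\row_t Kt t 2))
    (const_mx 0)    (row_mx (\row_t M t 2) (\row_t Mt t 2)).

Definition Qmid (k : nat) : 'M['M[A]_2]_(1 + (r1 + r2)) :=
  block_mx
    (const_mx blkI) (row_mx (\row_t K t k) (\row_t Kt t k))
    0 (block_mx (diag_mx (\row_t M t k)) 0
                0                        (diag_mx (\row_t Mt t k))).

Definition QL : 'M['M[A]_2]_(1 + (r1 + r2), 1) :=
  col_mx (const_mx (gamma1 *: blkI + gamma2 *: blkJ' + gamma3 *: blkJ))
    (col_mx (\col_t ((alpha t * w t) *: M t L))
            (\col_t ((beta t * z t) *: Mt t L))).

(* Q_(L - n), ..., Q_(L - 1), Q_L *)
Fixpoint BL_last_cores (n : nat) :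
    qtt_cores A (1 + (r1 + r2)) (nseq n (1 + (r1 + r2))%N) :=
  match n return qtt_cores A (1 + (r1 + r2)) (nseq n (1 + (r1 + r2))%N) with
  | 0 => QttLast QL
  | n'.+1 => QttCons (Qmid (L - n'.+1)) (BL_last_cores n')
  end.

(* Q_1, Q_2, Q_3, ..., Q_L, for L > 2 *)
Definition BL_cores :
    qtt_cores A 1 [:: 2, 1 + (r1 + r2) & nseq (L - 3) (1 + (r1 + r2))]%N :=
  QttCons Q1 (QttCons Q2 (BL_last_cores (L - 3))).

End ExponentialCirculant.

(* Main.v *)
Require Import Defs.
From mathcomp Require Import all_boot all_order all_algebra.
From mathcomp Require Import mxtens complex reals.
From mathcomp Require Import zify.

(** Split the binary digits of the row and column indices [i], [j] from the
    most significant one.  The digit pair [(i0, j0)] of [M_(t,k)] selects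
    [q_(t,k) ^ (1 + i0 - j0)], so the product of the trailing blocks
    [M_(t,k)], ..., [M_(t,L)] telescopes to [w_t ^ (N - 1 + i - j)], where
    [N = 2 ^ (L - k + 1)].  The first row of the trailing product is the
    leading [N x N] block of [B_L]: equal digits recurse through [I], and a
    digit pair [(1, 0)] or [(0, 1)] fixes the sign of [i - j], whence the
    exponent is read off through [K] and [Kt]. *)

Set Implicit Arguments.
Unset Strict Implicit.
Unset Printing Implicit Defensive.

Import GRing.Theory.
Local Open Scope ring_scope.

(** * Entries of strong Kronecker products *)

Lemma strong_kronE (A : pzRingType) (m n m' n' p q r : nat)
    (X : 'M['M[A]_(m, n)]_(p, q)) (Y : 'M['M[A]_(m', n')]_(q, r)) a b i0 i j0 j :
  strong_kron X Y a b (mxtens_index (i0, i)) (mxtens_index (j0, j)) =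
  \sum_c X a c i0 j0 * Y c b i j.
Proof.
by rewrite mxE summxE; apply: eq_bigr => c _; rewrite tensmxE.
Qed.

Lemma strong_kron_col_mx (A : pzRingType) (m n m' n' p1 p2 q r : nat)
    (X1 : 'M['M[A]_(m, n)]_(p1, q)) (X2 : 'M['M[A]_(m, n)]_(p2, q))
    (Y : 'M['M[A]_(m', n')]_(q, r)) :
  strong_kron (col_mx X1 X2) Y =
  col_mx (strong_kron X1 Y) (strong_kron X2 Y).
Proof.
apply/matrixP => a b; rewrite [LHS]mxE.
by case: (split_ordP a) => a' ->; rewrite ?(col_mxEu, col_mxEd) [RHS]mxE;
  apply: eq_bigr => c _; rewrite ?(col_mxEu, col_mxEd).
Qed.

Lemma sum_ord_block (V : nmodType) (r1 r2 : nat) (F : 'I_(1 + (r1 + r2)) -> V) :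
  \sum_c F c = F (lshift _ 0) + (\sum_t F (rshift 1 (lshift r2 t))
                                 + \sum_t F (rshift 1 (rshift r1 t))).
Proof. by rewrite !big_split_ord big_ord1. Qed.

Section Suffixes.
Variables (A : comPzRingType) (L r1 r2 : nat).
Variables (alpha w : 'I_r1 -> A) (beta z : 'I_r2 -> A).

Local Notation c := (BL_column L alpha w beta z).
Local Notation "2^L" := (2 ^ L)%N.

(** * Entries of the blocks, and the invariant of trailing products *)

Lemma blkIE (i j : 'I_2) : (blkI : 'M[A]_2) i j = (i == j)%:R.
Proof. by rewrite mxE. Qed.

(** As [j <= 1], the subtraction never truncates: a single power covers the whole block, and
    exponents simply add under products. *)
Lemma ME t k (i j : 'I_2) : M L w t k i j = q L w t k ^+ (i.+1 - j).
Proof.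
by rewrite !mxE; case: i j => [[|[|//]] ?] [[|[|//]] ?];
  rewrite /= !(mulr1, mulr0, addr0, add0r) ?expr1 ?expr0.
Qed.

Lemma MtE t k (i j : 'I_2) : Mt L z t k i j = qt L z t k ^+ (j.+1 - i).
Proof.
by rewrite !mxE; case: i j => [[|[|//]] ?] [[|[|//]] ?];
  rewrite /= !(mulr1, mulr0, addr0, add0r) ?expr1 ?expr0.
Qed.

Lemma KE t k (i j : 'I_2) :
  K L w t k i j = if (j < i)%N then 1 else
                  if (i < j)%N then q L w t k ^+ (2 ^ k - 2) else 0.
Proof.
by rewrite !mxE; case: i j => [[|[|//]] ?] [[|[|//]] ?];
  rewrite /= !(mulr1, mulr0, addr0, add0r).
Qed.

Lemma KtE t k (i j : 'I_2) :
  Kt L z t k i j = if (j < i)%N then qt L z t k ^+ (2 ^ k - 2) else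
                   if (i < j)%N then 1 else 0.
Proof.
by rewrite !mxE; case: i j => [[|[|//]] ?] [[|[|//]] ?];
  rewrite /= !(mulr1, mulr0, addr0, add0r).
Qed.

(** The induction invariant for a trailing product with [N] by [N] blocks. Adding [N] keeps the
    exponents of the Toeplitz blocks positive, so natural subtraction is exact. *)
Definition suffix_spec N (Y : 'M['M[A]_N]_(1 + (r1 + r2), 1)) : Prop :=
  [/\ forall i j, Y (lshift _ 0) 0 i j = c ((i + 2^L - j) %% 2^L),
      forall t i j, Y (rshift 1 (lshift r2 t)) 0 i j
                    = alpha t * w t ^+ (N + i - j) &
      forall t i j, Y (rshift 1 (rshift r1 t)) 0 i j
                    = beta t * z t ^+ (N + j - i)].

Lemma QL_spec : (0 < L)%N -> suffix_spec (QL L alpha w beta z).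
Proof.
move=> L0; have L2 : (2 <= 2^L)%N by rewrite -{1}(expn1 2) leq_pexp2l.
split=> [i j|t i j|t i j]; rewrite /QL.
- rewrite col_mxEu !mxE.
  case: i j => [[|[|//]] ?] [[|[|//]] ?];
    rewrite /= !(mulr1, mulr0, addr0, add0r).
  + rewrite subn0 modnn /gamma1 /BL_column subn0.
    by congr (_ + _); apply: eq_bigr => t _; rewrite expr0 mulr1.
  + rewrite modn_small; last lia.
    rewrite /gamma3 /BL_column subKn; last lia.
    (* The exponent of [z t] is now 1, and [z t ^+ 1] is convertible to [z t]. *)
    by [].
  + rewrite subn0 modnDr modn_small; last lia.
    by rewrite /gamma2 /BL_column.
  + rewrite addKn modnn /gamma1 /BL_column subn0.
    by congr (_ + _); apply: eq_bigr => t _; rewrite expr0 mulr1.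
(* The extra factor [w t] in [QL] raises the exponent [1 + i - j] to [N + i - j] with [N = 2]. *)
- rewrite col_mxEd col_mxEu mxE mxE ME /q subnn expn0 expr1 -mulrA -exprS.
  by congr (_ * _ ^+ _); move: (ltn_ord i) (ltn_ord j); lia.
- rewrite col_mxEd col_mxEd mxE mxE MtE /qt subnn expn0 expr1 -mulrA -exprS.
  by congr (_ * _ ^+ _); move: (ltn_ord i) (ltn_ord j); lia.
Qed.

(** * Prepending one core to a trailing product *)

Section Step.
Variables (k N : nat) (Y : 'M['M[A]_N]_(1 + (r1 + r2), 1)).
Hypotheses (k0 : (0 < k)%N) (kL : (k <= L)%N) (NE : N = (2 ^ (L - k))%N).
Hypothesis Yspec : suffix_spec Y.

Lemma size_suffix : (2 * N <= 2^L)%N.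
Proof. by rewrite NE -expnS leq_pexp2l //; lia. Qed.

(** Since [q L w t k = w t ^+ N], the power in [K] is [w t ^+ (2^L - 2 * N)]: exactly the gap
    between the suffix exponent [N + i - j] and the wrapped index [2^L + i - (N + j)]. *)
Lemma K_exponent : (N * (2 ^ k - 2) = 2^L - 2 * N)%N.
Proof. by rewrite mulnBr [(N * 2)%N]mulnC NE -expnD subnK. Qed.

(** Kept apart from the middle cores because [Q2] has the same first row. *)
Lemma K_row_spec (i j : 'I_(2 * N)) :
  strong_kron
    (row_mx (const_mx blkI) (row_mx (\row_t K L w t k) (\row_t Kt L z t k)))
    Y 0 0 i j = c ((i + 2^L - j) %% 2^L).
Proof.
have [Y0 Y1 Y2] := Yspec.
have N2 := size_suffix; have eK := K_exponent.
case: (mxtens_indexP i) (mxtens_indexP j) => i0 {}i [j0 {}j].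
rewrite strong_kronE sum_ord_block row_mxEl mxE blkIE Y0.
under eq_bigr => t _ do rewrite row_mxEr row_mxEl mxE KE Y1 /q -NE -exprM eK.
under [X in _ + (_ + X)]eq_bigr => t _
  do rewrite row_mxEr row_mxEr mxE KtE Y2 /qt -NE -exprM eK.
have iN := ltn_ord i; have jN := ltn_ord j.
case: i0 j0 => [[|[|//]] ?] [[|[|//]] ?] /=.
- rewrite !big1 => [|t _|t _]; rewrite ?mul0r // mul1r !addr0.
  by congr (c (_ %% _)); lia.
(* Digits (0, 1), above the diagonal: the index is [2^L - N + i - j], so the [w] terms take the
   correction and the [z] terms have weight 1. *)
- rewrite mul0r add0r modn_small; last lia.
  congr (_ + _); apply: eq_bigr => t _.
    by rewrite mulrCA -exprD; congr (_ * _ ^+ _); lia.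
  by rewrite mul1r; congr (_ * _ ^+ _); lia.
(* Digits (1, 0), below the diagonal: the index is [N + i - j], and the roles of [w] and [z] are
   exchanged. *)
- rewrite mul0r add0r.
  have -> : (1 * N + i + 2^L - (0 * N + j) = N + i - j + 2^L)%N by lia.
  rewrite modnDr modn_small; last lia.
  congr (_ + _); apply: eq_bigr => t _; first by rewrite mul1r.
  by rewrite mulrCA -exprD; congr (_ * _ ^+ _); lia.
- rewrite !big1 => [|t _|t _]; rewrite ?mul0r // mul1r !addr0.
  by congr (c (_ %% _)); lia.
Qed.

Lemma M_suffix t i0 j0 (i j : 'I_N) :
  M L w t k i0 j0 * Y (rshift 1 (lshift r2 t)) 0 i j =
  alpha t * w t ^+ (2 * N + mxtens_index (i0, i) - mxtens_index (j0, j)).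
Proof.
have [_ Y1 _] := Yspec.
rewrite ME Y1 /q -NE -exprM mulrCA -exprD; congr (_ * _ ^+ _).
have iN := ltn_ord i; have jN := ltn_ord j.
by case: i0 j0 => [[|[|//]] ?] [[|[|//]] ?] /=; lia.
Qed.

Lemma Mt_suffix t i0 j0 (i j : 'I_N) :
  Mt L z t k i0 j0 * Y (rshift 1 (rshift r1 t)) 0 i j =
  beta t * z t ^+ (2 * N + mxtens_index (j0, j) - mxtens_index (i0, i)).
Proof.
have [_ _ Y2] := Yspec.
rewrite MtE Y2 /qt -NE -exprM mulrCA -exprD; congr (_ * _ ^+ _).
have iN := ltn_ord i; have jN := ltn_ord j.
by case: i0 j0 => [[|[|//]] ?] [[|[|//]] ?] /=; lia.
Qed.

(** The second row of [Q2] adds up the diagonal rows of a middle core, so it yields the sum of all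
    the exponentials. *)
Lemma M_row_spec (i j : 'I_(2 * N)) :
  strong_kron
    (row_mx (const_mx 0) (row_mx (\row_t M L w t k) (\row_t Mt L z t k)))
    Y 0 0 i j =
  \sum_t alpha t * w t ^+ (2 * N + i - j)
  + \sum_t beta t * z t ^+ (2 * N + j - i).
Proof.
case: (mxtens_indexP i) (mxtens_indexP j) => i0 {}i [j0 {}j].
rewrite strong_kronE sum_ord_block row_mxEl !mxE mul0r add0r.
congr (_ + _); apply: eq_bigr => t _.
  by rewrite row_mxEr row_mxEl mxE M_suffix.
by rewrite row_mxEr row_mxEr mxE Mt_suffix.
Qed.

Lemma Qmid_spec : suffix_spec (strong_kron (Qmid L w z k) Y).
Proof.
rewrite /Qmid /block_mx strong_kron_col_mx; split=> [i j|t i j|t i j].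
- by rewrite col_mxEu K_row_spec.
- case: (mxtens_indexP i) (mxtens_indexP j) => i0 {}i [j0 {}j].
  rewrite col_mxEd strong_kronE sum_ord_block.
  rewrite row_mxEl !mxE mul0r add0r (bigD1 t) //= row_mxEr block_mxEul !mxE.
  rewrite eqxx mulr1n M_suffix !big1 ?addr0 // => s.
    by rewrite row_mxEr block_mxEur !mxE mul0r.
  move=> /negbTE st.
  by rewrite row_mxEr block_mxEul !mxE eq_sym st mulr0n mxE mul0r.
- case: (mxtens_indexP i) (mxtens_indexP j) => i0 {}i [j0 {}j].
  rewrite col_mxEd strong_kronE sum_ord_block.
  rewrite row_mxEl !mxE mul0r add0r big1 => [|s _]; last first.
    by rewrite row_mxEr block_mxEdl !mxE mul0r.
  rewrite add0r (bigD1 t) //= row_mxEr block_mxEdr !mxE.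
  rewrite eqxx mulr1n Mt_suffix big1 ?addr0 // => s /negbTE st.
  by rewrite row_mxEr block_mxEdr !mxE eq_sym st mulr0n mxE mul0r.
Qed.

End Step.

(** * Assembling the full product *)

Lemma BL_last_cores_spec n : (n < L)%N ->
  suffix_spec (qtt_prod (BL_last_cores L alpha w beta z n)).
Proof.
elim: n => [|n IHn] nL /=; first exact: QL_spec.
apply: Qmid_spec; [lia | lia | | exact/IHn/ltnW].
by rewrite size_nseq subKn; last exact: ltnW.
Qed.

(** For [k = 1] the exponent [2 ^ k - 2] is 0, so every [K] and [Kt] would equal [H]. The
    exponentials then enter only through their sum, which is why rank 2 suffices after [Q1]. *)
Lemma Q1_Q2_suffix N (Y : 'M['M[A]_N]_(1 + (r1 + r2), 1))
    (i j : 'I_(2 * (2 * N))) :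
    (2 <= L)%N -> N = (2 ^ (L - 2))%N -> suffix_spec Y ->
  strong_kron (Q1 A) (strong_kron (Q2 L w z) Y) 0 0 i j
  = c ((i + 2^L - j) %% 2^L).
Proof.
move=> L2 NE Yspec.
have eL : (2 * (2 * N) = 2^L)%N.
  by rewrite NE -!expnS; congr (2 ^ _)%N; lia.
case: (mxtens_indexP i) (mxtens_indexP j) => i0 {}i [j0 {}j].
rewrite /Q2 /block_mx strong_kron_col_mx strong_kronE big_split_ord !big_ord1.
rewrite row_mxEl row_mxEr col_mxEu col_mxEd ![const_mx _ _ _]mxE.
rewrite (K_row_spec _ L2 NE Yspec) // (M_row_spec _ L2 NE Yspec) // !mxE.
have iN := ltn_ord i; have jN := ltn_ord j.
case: i0 j0 => [[|[|//]] ?] [[|[|//]] ?];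
  rewrite /= ?(addr0, add0r, mul1r, mul0r).
- by congr (c (_ %% _)); lia.
(* Wrapping gives [2^L - 2 * N = 2 * N], so both off-diagonal quarters have the same index
   [2 * N + i - j]. *)
- rewrite modn_small; last lia.
  by congr (_ + _); apply: eq_bigr => t _; congr (_ * _ ^+ _); lia.
- have -> : (1 * (2 * N) + i + 2^L - (0 * (2 * N) + j)
             = 2 * N + i - j + 2^L)%N by lia.
  rewrite modnDr modn_small; last lia.
  by congr (_ + _); apply: eq_bigr => t _; congr (_ * _ ^+ _); lia.
- by congr (c (_ %% _)); lia.
Qed.

Lemma BL_cores_prodE i j : (2 < L)%N ->
  qtt_prod (BL_cores L alpha w beta z) 0 0 i j = c ((i + 2^L - j) %% 2^L).
Proof.
move=> hL; pose Y := qtt_prod (BL_last_cores L alpha w beta z (L - 3)).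
apply: (Q1_Q2_suffix (Y := Y)); first exact: ltnW.
  by rewrite size_nseq; congr expn; lia.
by apply: BL_last_cores_spec; lia.
Qed.

End Suffixes.

Theorem corollary4p1 (R : realType) (L r1 r2 : nat) (hL : (2 < L)%N)
    (alpha w : 'I_r1 -> R[i]) (beta z : 'I_r2 -> R[i]) :
  qtt_representation
    (BL L alpha w beta z)
    (ranks := [:: 2, 1 + (r1 + r2) & nseq (L - 3) (1 + (r1 + r2))]%N)
    (BL_cores L alpha w beta z).
Proof.
have eL : (size [:: 2, 1 + (r1 + r2)
                  & nseq (L - 3) (1 + (r1 + r2))]%N).+1 = L.
  by rewrite /= size_nseq; lia.
exists eL; apply/matrixP => i j.
by rewrite castmxE BL_cores_prodE // mxE.
Qed.
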